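(* Let $X\subset\mathbb{R}^n$ be nonempty and open, let $f_j\colon X\to\mathbb{R}$ ($j\in J:=\{1,\dots,p\}$) and $g_i\colon X\to\mathbb{R}$ ($i\in I:=\{1,\dots,m\}$) be continuously differentiable, and let $\mathcal{F}:=\{x\in X: g_i(x)\le 0,\ i\in I\}$. Consider the vector optimization problem (VP) of minimizing $f=(f_1,\dots,f_p)$ over $\mathcal{F}$ with respect to the componentwise order. Let $\bar x\in\mathcal{F}$. Suppose that $f_j$, $j\in J$, and $g_i$, $i\in I(\bar x)$, are second-order directionally differentiable at $\bar x$ in every critical direction $d\in\mathcal{C}(\bar x)$, and that $f_j$, $j\in J$, and $g_i$, $i\in I(\bar x)$, are strictly $2$-pseudoconvex at $\bar x$. If for each $d\in\mathcal{C}(\bar x)$ there exists $(\mu,\lambda)\in(\mathbb{R}^p_+\times\mathbb{R}^m_+)\setminus\{(0,0)\}$ such that $$\sum_{j=1}^p\mu_j\nabla f_j(\bar x)+\sum_{i=1}^m\lambda_i\nabla g_i(\bar x)=0,$$ $$\sum_{j=1}^p\mu_j f_j''(\bar x;d)+\sum_{i=1}^m\lambda_i g_i''(\bar x;d)\ge0,$$ $$\lambda_i g_i(\bar x)=0\quad\text{for all } i\in I,$$ then $\bar x$ is a strict global efficient solution of (VP).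
   Context: $\langle\cdot,\cdot\rangle$ is the Euclidean scalar product; $\mathbb{R}^p_+$ is the nonnegative orthant. Second-order directional derivative (Demyanov--Pevnyi): for $\phi\colon X\to\mathbb{R}$ differentiable at $x\in X$ and $d\in\mathbb{R}^n$, $$\phi''(x;d):=\lim_{t\downarrow0}\frac{2}{t^2}\big[\phi(x+td)-\phi(x)-t\langle\nabla\phi(x),d\rangle\big];$$ $\phi$ is second-order directionally differentiable at $x$ in the direction $d$ if this limit exists and is finite. $I(\bar x):=\{i\in I: g_i(\bar x)=0\}$. The set of critical directions at $\bar x$ is $\mathcal{C}(\bar x):=\{d\in\mathbb{R}^n:\langle\nabla f_j(\bar x),d\rangle\le0\ \forall j\in J,\ \langle\nabla g_i(\bar x),d\rangle\le0\ \forall i\in I(\bar x)\}$. Strict $2$-pseudoconvexity: let $\phi\colon X\to\mathbb{R}$ be differentiable at $\bar x$ and second-order directionally differentiable at $\bar x$ in every direction $y-\bar x$ with $y\in X$, $\phi(y)\le\phi(\bar x)$, $\langle\nabla\phi(\bar x),y-\bar x\rangle=0$. Then $\phi$ is strictly $2$-pseudoconvex at $\bar x$ if for all $y\in X$ with $y\ne\bar x$: (i) $\phi(y)\le\phi(\bar x)$ implies $\langle\nabla\phi(\bar x),y-\bar x\rangle\le0$; (ii) $\phi(y)\le\phi(\bar x)$ and $\langle\nabla\phi(\bar x),y-\bar x\rangle=0$ imply $\phi''(\bar x;y-\bar x)<0$. Strict global efficient solution: $\bar x\in\mathcal{F}$ such that there is no $x\in\mathcal{F}$ with $x\ne\bar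 x$ and $f_j(x)\le f_j(\bar x)$ for all $j\in J$. Convention: a term $\lambda_i g_i''(\bar x;d)$ with $\lambda_i=0$ (in particular with $i\notin I(\bar x)$) is taken to be $0$. *)

(* Defs.v *)
From HB Require Import structures.
From mathcomp Require Import all_boot all_order all_algebra.
From mathcomp Require Import all_classical all_reals all_analysis.
Set Implicit Arguments.
Unset Strict Implicit.
Unset Printing Implicit Defensive.
Import Order.TTheory GRing.Theory Num.Theory.
Import numFieldNormedType.Exports.
Local Open Scope classical_set_scope.
Local Open Scope ring_scope.

(* A function on an open set X of R^n is represented by a total function on
   'rV[R]_n. The derivatives below depend only on its germ at a point of X, and
   its values are only compared at points of X, so its values outside X are
   irrelevant. The norm of 'rV[R]_n in the library is the sup norm, which
   defines the same topology and differentiability as the Euclidean one. *)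

Definition dotv (R : realType) (n : nat) (u v : 'rV[R]_n) : R :=
  \sum_(k < n) u 0 k * v 0 k.

Definition gradient (R : realType) (n : nat) (phi : 'rV[R]_n -> R)
    (x : 'rV[R]_n) : 'rV[R]_n :=
  \row_(k < n) 'D_(delta_mx 0 k) phi x.

Definition continuously_differentiable_on (R : realType) (n : nat)
    (X : set 'rV[R]_n) (phi : 'rV[R]_n -> R) : Prop :=
  (forall x, X x -> differentiable phi x) /\
  {within X, continuous (gradient phi)}.

Definition second_order_quotient (R : realType) (n : nat)
    (phi : 'rV[R]_n -> R) (x d : 'rV[R]_n) (t : R) : R :=
  2 / t ^+ 2 * (phi (x + t *: d) - phi x - t * dotv (gradient phi x) d).

(* Convergence is in R, so the limit is finite. *)
Definition second_order_dir_differentiable (R : realType) (n : nat)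
    (phi : 'rV[R]_n -> R) (x d : 'rV[R]_n) : Prop :=
  cvg (second_order_quotient phi x d t @[t --> 0^'+]).

(* When the limit does not exist this is an unspecified real number, so that
   0 * second_order_dir_derivative phi x d = 0 in all cases. *)
Definition second_order_dir_derivative (R : realType) (n : nat)
    (phi : 'rV[R]_n -> R) (x d : 'rV[R]_n) : R :=
  lim (second_order_quotient phi x d t @[t --> 0^'+]).

(* The first two clauses are the standing assumptions under which the notion
   is defined. *)
Definition strictly_2_pseudoconvex (R : realType) (n : nat)
    (X : set 'rV[R]_n) (phi : 'rV[R]_n -> R) (xbar : 'rV[R]_n) : Prop :=
  [/\ differentiable phi xbar,
      forall y, X y -> phi y <= phi xbar ->
        dotv (gradient phi xbar) (y - xbar) = 0 ->
        second_order_dir_differentiable phi xbar (y - xbar) &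
      forall y, X y -> y <> xbar ->
        (phi y <= phi xbar -> dotv (gradient phi xbar) (y - xbar) <= 0) /\
        (phi y <= phi xbar -> dotv (gradient phi xbar) (y - xbar) = 0 ->
         second_order_dir_derivative phi xbar (y - xbar) < 0)].

Definition feasible_set (R : realType) (n m : nat) (X : set 'rV[R]_n)
    (g : 'I_m -> 'rV[R]_n -> R) : set 'rV[R]_n :=
  [set x | X x /\ forall i, g i x <= 0].

Definition active_set (R : realType) (n m : nat)
    (g : 'I_m -> 'rV[R]_n -> R) (xbar : 'rV[R]_n) : set 'I_m :=
  [set i | g i xbar = 0].

Definition critical_directions (R : realType) (n p m : nat)
    (f : 'I_p -> 'rV[R]_n -> R) (g : 'I_m -> 'rV[R]_n -> R)
    (xbar : 'rV[R]_n) : set 'rV[R]_n :=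
  [set d | (forall j, dotv (gradient (f j) xbar) d <= 0) /\
           (forall i, active_set g xbar i ->
              dotv (gradient (g i) xbar) d <= 0)].

Definition strict_global_efficient (R : realType) (n p m : nat)
    (X : set 'rV[R]_n) (f : 'I_p -> 'rV[R]_n -> R)
    (g : 'I_m -> 'rV[R]_n -> R) (xbar : 'rV[R]_n) : Prop :=
  feasible_set X g xbar /\
  ~ (exists x, [/\ feasible_set X g x, x <> xbar &
                   forall j, f j x <= f j xbar]).

(* Main.v *)
(* If a feasible x <> xbar were no worse than xbar for every objective, then
   d = x - xbar would be critical. Pairing the multiplier equation with d writes
   0 as a sum of nonpositive terms, so each term vanishes; hence a positive
   multiplier belongs to a gradient orthogonal to d, and so, by strict
   2-pseudoconvexity, to a negative second-order derivative. The second-order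
   inequality then forces all multipliers to be zero. *)

Require Import Defs.
From HB Require Import structures.
From mathcomp Require Import all_boot all_order all_algebra.
From mathcomp Require Import all_classical all_reals all_analysis.
Set Implicit Arguments.
Unset Strict Implicit.
Unset Printing Implicit Defensive.
Import Order.TTheory GRing.Theory Num.Theory.
Import numFieldNormedType.Exports.
Local Open Scope classical_set_scope.
Local Open Scope ring_scope.

Lemma dotv_suml (R : realType) (n : nat) (I : finType) (c : I -> R)
    (u : I -> 'rV[R]_n) (v : 'rV[R]_n) :
  dotv (\sum_i c i *: u i) v = \sum_i c i * dotv (u i) v.
Proof.
under [RHS]eq_bigr do rewrite mulr_sumr.
rewrite exchange_big; apply: eq_bigr => k _.
by rewrite summxE mulr_suml; apply: eq_bigr => i _; rewrite mxE mulrA.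
Qed.

Lemma dotvDl (R : realType) (n : nat) (u v w : 'rV[R]_n) :
  dotv (u + v) w = dotv u w + dotv v w.
Proof. by rewrite -big_split; apply: eq_bigr => k _; rewrite mxE mulrDl. Qed.

Lemma dot0v (R : realType) (n : nat) (v : 'rV[R]_n) : dotv 0 v = 0.
Proof. by apply: big1 => k _; rewrite mxE mul0r. Qed.

Lemma sumr_nonpos_eq0 (R : numDomainType) (I : finType) (F : I -> R) :
  (forall i, F i <= 0) -> 0 <= \sum_i F i -> forall i, F i = 0.
Proof.
move=> F_le0 sum_ge0 i; apply: oppr_inj; rewrite oppr0.
apply: (psumr_eq0P (P := xpredT) (F := fun i => - F i)) => // [j _|].
  by rewrite oppr_ge0.
apply/eqP; rewrite sumrN oppr_eq0 eq_le sum_ge0 andbT.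
exact: sumr_le0.
Qed.

(** Dropping one nonpositive sum can only increase the total, so each sum is nonnegative by itself.
    This serves twice: for the first-order terms of the objectives and constraints, then for the
    second-order ones. *)
Lemma sumr2_nonpos_eq0 (R : numDomainType) (I J : finType) (F : I -> R)
    (G : J -> R) :
  (forall i, F i <= 0) -> (forall j, G j <= 0) ->
  0 <= \sum_i F i + \sum_j G j ->
  (forall i, F i = 0) /\ (forall j, G j = 0).
Proof.
move=> F_le0 G_le0 sum_ge0; split; apply: sumr_nonpos_eq0 => //;
  apply: le_trans sum_ge0 _.
- by rewrite gerDl sumr_le0.
- by rewrite gerDr sumr_le0.
Qed.

(** If [c] is positive, the vanishing product makes [y - x] orthogonal to the gradient, and
    strictness applies. The [?= iff] form keeps both the sign needed for summation and the equality
    case that later gives [c = 0]. *)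
Lemma strictly_2_pseudoconvex_weight (R : realType) (n : nat)
    (X : set 'rV[R]_n) (phi : 'rV[R]_n -> R) (x y : 'rV[R]_n) (c : R) :
  strictly_2_pseudoconvex X phi x -> X y -> y <> x -> phi y <= phi x ->
  0 <= c -> c * dotv (gradient phi x) (y - x) = 0 ->
  c * second_order_dir_derivative phi x (y - x) <= 0 ?= iff (c == 0).
Proof.
move=> [_ _ pc] Xy yx phi_le; have [_ neg] := pc y Xy yx.
rewrite le_eqVlt => /predU1P[<- _|c_gt0 /eqP].
  by rewrite mul0r eqxx; exact/leif_refl.
rewrite mulf_eq0 gt_eqF //= => /eqP /(neg phi_le) lt0.
split; first by rewrite ltW // pmulr_rlt0.
by rewrite mulf_eq0 (lt_eqF lt0) gt_eqF.
Qed.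

Theorem theorem3p3 (R : realType) (n p m : nat) (X : set 'rV[R]_n)
    (f : 'I_p -> 'rV[R]_n -> R) (g : 'I_m -> 'rV[R]_n -> R)
    (xbar : 'rV[R]_n)
    (X_nonempty : X !=set0) (X_open : open X)
    (f_C1 : forall j, continuously_differentiable_on X (f j))
    (g_C1 : forall i, continuously_differentiable_on X (g i))
    (xbar_feasible : feasible_set X g xbar)
    (f_dir2 : forall j d, critical_directions f g xbar d ->
       second_order_dir_differentiable (f j) xbar d)
    (g_dir2 : forall i d, active_set g xbar i ->
       critical_directions f g xbar d ->
       second_order_dir_differentiable (g i) xbar d)
    (f_pc : forall j, strictly_2_pseudoconvex X (f j) xbar)
    (g_pc : forall i, active_set g xbar i ->
       strictly_2_pseudoconvex X (g i) xbar)
    (multipliers : forall d, critical_directions f g xbar d ->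
       exists (mu : 'rV[R]_p) (lam : 'rV[R]_m),
         [/\ (forall j, 0 <= mu 0 j) /\ (forall i, 0 <= lam 0 i),
             (mu, lam) <> (0, 0),
             \sum_(j < p) mu 0 j *: gradient (f j) xbar +
               \sum_(i < m) lam 0 i *: gradient (g i) xbar = 0,
             0 <= \sum_(j < p) mu 0 j * second_order_dir_derivative (f j) xbar d +
               \sum_(i < m) lam 0 i * second_order_dir_derivative (g i) xbar d &
             forall i, lam 0 i * g i xbar = 0]) :
  strict_global_efficient X f g xbar.
Proof.
split=> // -[x [[Xx gx_le0] x_neq fx_le]].
(* Active constraints vanish at [xbar], so feasibility of [x] is exactly the comparison that
   pseudoconvexity asks for. *)
have gx_le i : active_set g xbar i -> g i x <= g i xbar by move=> ->.
have f_dot j : dotv (gradient (f j) xbar) (x - xbar) <= 0.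
  by have [_ _ pc] := f_pc j; apply: (pc x Xx x_neq).1.
have g_dot i : active_set g xbar i -> dotv (gradient (g i) xbar) (x - xbar) <= 0.
  by move=> act; have [_ _ pc] := g_pc i act; apply: (pc x Xx x_neq).1 (gx_le i act).
have [mu [lam [[mu_ge0 lam_ge0] nz stat second compl]]] :=
  multipliers _ (conj f_dot g_dot).
(* Inactive constraints carry no sign or pseudoconvexity information; complementarity removes them
   from both sums. *)
have lamP i : lam 0 i = 0 \/ active_set g xbar i.
  by move/eqP: (compl i); rewrite mulf_eq0 => /orP[]/eqP; [left | right].
have [mu_dot lam_dot] :
    (forall j, mu 0 j * dotv (gradient (f j) xbar) (x - xbar) = 0) /\
    (forall i, lam 0 i * dotv (gradient (g i) xbar) (x - xbar) = 0).
  apply: sumr2_nonpos_eq0 => [j|i|].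
  - exact: mulr_ge0_le0.
  - have [->|act] := lamP i; first by rewrite mul0r.
    exact: mulr_ge0_le0 (g_dot i act).
  (* The two sums together are the stationarity equation paired with [x - xbar], so the bound reads
     [0 <= 0]. *)
  - by rewrite -!dotv_suml -dotvDl stat dot0v.
have mu_second j := strictly_2_pseudoconvex_weight (f_pc j) Xx x_neq (fx_le j)
  (mu_ge0 j) (mu_dot j).
have lam_second i : lam 0 i * second_order_dir_derivative (g i) xbar (x - xbar)
    <= 0 ?= iff (lam 0 i == 0).
  (* With a zero multiplier the term is 0 even if the limit defining the second derivative does not
     exist. *)
  have [->|act] := lamP i; first by rewrite mul0r eqxx; exact/leif_refl.
  exact: strictly_2_pseudoconvex_weight (g_pc i act) Xx x_neq (gx_le i act)
    (lam_ge0 i) (lam_dot i).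
have [mu0 lam0] := sumr2_nonpos_eq0 (fun j => (mu_second j).1)
  (fun i => (lam_second i).1) second.
(* All second-order terms are now 0, and the equality case of each [?= iff] turns this into a zero
   multiplier. *)
apply: nz; congr (_, _); apply/rowP => k; rewrite mxE; apply/eqP.
- by rewrite -(mu_second k).2 mu0.
- by rewrite -(lam_second k).2 lam0.
Qed.
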